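(* Let $a,b,c,p\in\mathbb{C}$ with $-c\notin\mathbb{N}\cup\{0\}$ and $c\neq2$. Suppose that $\sinh(pz)F(a,b;c;z)=\sum_{n=0}^\infty u_nz^n$ for $|z|<1$. Then $u_0=0$, $u_1=p$, $u_2=\frac{abp}{c}$, $u_3=\frac{(a)_2(b)_2p}{2(c)_2}+\frac{p^3}{6}$, $u_4=\frac{abp^3}{6c}+\frac{(a)_3(b)_3p}{6(c)_3}$, $u_5=\frac{(a)_2(b)_2p^3}{12(c)_2}+\frac{(a)_4(b)_4p}{24(c)_4}+\frac{p^5}{120}$, $u_6=\frac{abp^5}{120c}+\frac{(a)_3(b)_3p^3}{36(c)_3}+\frac{(a)_5(b)_5p}{120(c)_5}$, $u_7=\frac{(a)_2(b)_2p^5}{240(c)_2}+\frac{(a)_4(b)_4p^3}{144(c)_4}+\frac{(a)_6(b)_6p}{720(c)_6}+\frac{p^7}{5040}$, $u_8=\frac{abp^7}{5040c}+\frac{(a)_3(b)_3p^5}{720(c)_3}+\frac{(a)_5(b)_5p^3}{720(c)_5}+\frac{(a)_7(b)_7p}{5040(c)_7}$, $u_9=\frac{(a)_2(b)_2p^7}{10080(c)_2}+\frac{(a)_4(b)_4p^5}{2880(c)_4}+\frac{(a)_6(b)_6p^3}{4320(c)_6}+\frac{(a)_8(b)_8p}{40320(c)_8}+\frac{p^9}{362880}$, and for all integers $n\ge9$, \[ u_{n+1}=\sum_{i=0}^9\delta_i(n)u_{n-i}, \] where $D(n)=(c-2)c\,n(n+1)(c+n-1)(c+n)$ and \[ \delta_0(n)=\frac{2(n-1)^2\left(a(c-2b)+c(b+c-3)\right)+4(c-2)(n-1)\left(c(a+b)-ab\right)+2ab(c-2)(c+1)}{(c-2)c(n+1)(c+n)},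 \] \[ \begin{aligned} \delta_1(n)=\frac{1}{D(n)}\Big[&-(n-4)(n-3)(n-2)(n-1)\left(a^2+4c(a+b)-10ab+b^2+c^2-6c-4p^2-1\right)\\ &+2(n-3)(n-2)(n-1)\Big(a^2(4b-3c)+a\left(2(b-1)c+4b(b+3)-3c^2\right)-c\left(b(3b+3c+2)+c-4p^2-13\right)\Big)\\ &+(n-2)(n-1)\Big(a^2\left(8b^2+b(4c+6)-6c^2+c\right)+a\left(-(10b+7)c^2+4(b(b+3)+3)c+6b(b+1)\right)\\ &\qquad+c\left(b^2(1-6c)+b(12-7c)+6(c-2)p^2+c+11\right)\Big)\\ &+(c-2)\left(a^2b(c-b(c+2))+ab(b+1)c+c^2(c+1)p^2\right)\\ &+2(n-1)\left(a^2b(b(4c-2)-3(c-1)c)-abc(3b(c-1)+c-5)+(c-2)c(c+1)p^2\right)\Big], \end{aligned} \] \[ \begin{aligned} \delta_2(n)=\frac{2}{D(n)}\Big[&(n-5)(n-4)(n-3)(n-2)\left(a^2+a(c-4b)+(b-1)(b+c+1)-8p^2\right)\\ &+(n-4)(n-3)(n-2)\Big(a^3+a^2(-5b+3c+2)-a\left(b(5b-2c+14)-3c+4p^2+1\right)+(b+3c+1)\left(b^2+b-4p^2-2\right)\Big)\\ &-(n-3)(n-2)\Big(a^3(b-2c)+a^2(b(10b+9)-4(b+1)c)+a\left(b(b+1)(b-4c+8)+6cp^2+2c\right)\\ &\qquad+2c\left(-b^3-2b^2+3p^2(b+c-3)+b+2\right)\Big)\\ &-(n-2)\Big(a^3b(4b-3c+2)+a^2b(2b+1)(2b-c)-a\left(p^2(10b-3c^2+c)+(b-1)b(b(3c-2)+4c-2)\right)\\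 &\qquad+cp^2\left(b(3c-1)+c^2-9\right)\Big)\\ &-(c+1)p^2\left(c^2(2a+2b+1)-3(a+1)(b+1)c+4ab\right)\\ &-(a-1)a(b-1)b\left(-c(a+b+1)+2ab+a+b+1\right)\Big], \end{aligned} \] \[ \begin{aligned} \delta_3(n)=-\frac{1}{D(n)}\Big[&(n-6)(n-5)(n-4)(n-3)\left((a-b)^2-24p^2-1\right)\\ &+2(n-5)(n-4)(n-3)\Big(a^3-a^2(b-2)-a\left(b(b+4)+12p^2+1\right)+b^3+2b^2-12p^2(b+c+1)-b-2\Big)\\ &+(n-4)(n-3)\Big(a^4+a^3(2b+3)-a^2\left(6b^2+3b+6p^2-1\right)+a\left(-12p^2(b+2c)+b(b(2b-3)-8)-3\right)\\ &\qquad-6p^2\left(b^2+4bc+(c-6)c-1\right)+(b+1)^2\left(b^2+b-2\right)+8p^4\Big)\\ &+2(n-3)\Big(-p^2\left(c^2(3a+3b+1)+c(a+b)(3a+3b+2)-40ab-13c\right)+ab(a-b-1)(a-b+1)(a+b)+4cp^4\Big)\\ &+a^4(b-1)b+a^3b(-2b^2+b+1)+a^2\left(b^4+b^3+p^2\left(-12b^2+2b(6c+5)-6c^2+c\right)-3b^2+b\right)\\ &+ap^2\left(-(6b+7)c^2+4(b(3b+2)+3)c+2b(5b-11)\right)\\ &-a(b-1)^2b(b+1)+cp^2\left(b^2(1-6c)+b(12-7c)+5(c-2)p^2+c+11\right)\Big], \end{aligned} \] \[ \begin{aligned} \delta_4(n)=\frac{2p^2}{D(n)}\Big[&-8(n-7)(n-6)(n-5)(n-4)-4(n-6)(n-5)(n-4)\left(3(a+b+1)+c\right)\\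 &+2(n-5)(n-4)\left(8p^2-3(a+b-1)(a+b+c+1)\right)\\ &+(n-4)\Big(-a^3-a^2(3b+3c+2)+a\left(b(-3b-6c+46)-3c+4p^2+1\right)-(b+3c+1)\left(b^2+b-4p^2-2\right)\Big)\\ &+a^3(3b-2c)+a^2(3(5-2b)b-4c)+a\left(p^2(5c-6b)-4bc+3b(b(b+5)-4)+2c\right)\\ &+5cp^2(b+c-3)-2(b-1)(b+1)(b+2)c\Big], \end{aligned} \] \[ \begin{aligned} \delta_5(n)=\frac{p^2}{D(n)}\Big[&4(n-8)(n-7)(n-6)(n-5)+8(n-7)(n-6)(n-5)(a+b+1)\\ &+6(n-6)(n-5)\left((a+b)^2-8p^2-1\right)\\ &-2(n-5)\left(-a^3-3a^2b-2a^2-3ab^2+12p^2(a+b+c+1)+16ab+a-b^3-2b^2+b+2\right)\\ &+a^4+a^3(3-2b)+a^2\left(b(6b-11)-5p^2+1\right)-a\left(2b^3+11b^2-2b(13p^2+6)+20cp^2+3\right)\\ &-5p^2\left(b^2+4bc+(c-6)c-1\right)+(b+1)^2\left(b^2+b-2\right)+4p^4\Big], \end{aligned} \] \[ \delta_6(n)=\frac{2p^4\left(5a^2+a(-8b+5c+12n-72)+5b^2+5bc+12b(n-6)+4n(c+4n)-29c-196n-8p^2+595\right)}{D(n)}, \] \[ \delta_7(n)=\frac{p^4\left(-5a^2+2a(b-4n+28)-5b^2-8b(n-7)-8(n-14)n+24p^2-387\right)}{D(n)}, \] \[ \delta_8(n)=-\frac{16p^6}{D(n)},\qquad \delta_9(n)=\frac{4p^6}{D(n)}.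 \]
   Context: For $a\in\mathbb{C}$, $(a)_n=a(a+1)\cdots(a+n-1)$ denotes the Pochhammer symbol, with $(a)_0=1$. For $a,b,c\in\mathbb{C}$ with $-c\notin\mathbb{N}\cup\{0\}$, the Gaussian hypergeometric function is $F(a,b;c;z)=\sum_{n=0}^\infty \frac{(a)_n(b)_n}{(c)_n\,n!}z^n$, $|z|<1$. *)

(* Defs.v *)
From HB Require Import structures.
From mathcomp Require Import all_boot all_order all_algebra.
From mathcomp Require Export complex.
From mathcomp Require Export all_classical all_reals all_analysis.
Export Order.TTheory GRing.Theory Num.Theory numFieldNormedType.Exports.

Set Implicit Arguments.
Unset Strict Implicit.
Unset Printing Implicit Defensive.

Local Open Scope ring_scope.

(* The complex numbers over a real field R, seen as a numClosedFieldType so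
   that the topology/normed structure of MathComp-Analysis applies. *)
Definition Cplx (R : realType) : numClosedFieldType := R[i].

Section Defs.
Variable R : realType.
Local Notation C := (Cplx R).

Definition poch (a : C) (n : nat) : C := \prod_(i < n) (a + i%:R).

Definition hypgeom (a b c z : C) : C :=
  limn (series (fun n => poch a n * poch b n / (poch c n * (n`!)%:R) * z ^+ n)).

Definition csinh (w : C) : C :=
  limn (series (fun k => if odd k then w ^+ k / (k`!)%:R else 0)).

Definition Dn (c x : C) : C := (c - 2) * c * x * (x + 1) * (c + x - 1) * (c + x).

Definition delta0 (a b c p x : C) : C :=
  (2 * (x - 1) ^+ 2 * (a * (c - 2 * b) + c * (b + c - 3))
   + 4 * (c - 2) * (x - 1) * (c * (a + b) - a * b)
   + 2 * a * b * (c - 2) * (c + 1))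
  / ((c - 2) * c * (x + 1) * (c + x)).

Definition delta1 (a b c p x : C) : C :=
  1 / Dn c x *
  ( - (x - 4) * (x - 3) * (x - 2) * (x - 1)
        * (a ^+ 2 + 4 * c * (a + b) - 10 * a * b + b ^+ 2 + c ^+ 2 - 6 * c - 4 * p ^+ 2 - 1)
    + 2 * (x - 3) * (x - 2) * (x - 1)
        * (a ^+ 2 * (4 * b - 3 * c)
           + a * (2 * (b - 1) * c + 4 * b * (b + 3) - 3 * c ^+ 2)
           - c * (b * (3 * b + 3 * c + 2) + c - 4 * p ^+ 2 - 13))
    + (x - 2) * (x - 1)
        * (a ^+ 2 * (8 * b ^+ 2 + b * (4 * c + 6) - 6 * c ^+ 2 + c)
           + a * (- ((10 * b + 7) * c ^+ 2) + 4 * (b * (b + 3) + 3) * c + 6 * b * (b + 1))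
           + c * (b ^+ 2 * (1 - 6 * c) + b * (12 - 7 * c) + 6 * (c - 2) * p ^+ 2 + c + 11))
    + (c - 2) * (a ^+ 2 * b * (c - b * (c + 2)) + a * b * (b + 1) * c
                 + c ^+ 2 * (c + 1) * p ^+ 2)
    + 2 * (x - 1)
        * (a ^+ 2 * b * (b * (4 * c - 2) - 3 * (c - 1) * c)
           - a * b * c * (3 * b * (c - 1) + c - 5)
           + (c - 2) * c * (c + 1) * p ^+ 2)).

Definition delta2 (a b c p x : C) : C :=
  2 / Dn c x *
  ( (x - 5) * (x - 4) * (x - 3) * (x - 2)
        * (a ^+ 2 + a * (c - 4 * b) + (b - 1) * (b + c + 1) - 8 * p ^+ 2)
    + (x - 4) * (x - 3) * (x - 2)
        * (a ^+ 3 + a ^+ 2 * (- 5 * b + 3 * c + 2)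
           - a * (b * (5 * b - 2 * c + 14) - 3 * c + 4 * p ^+ 2 + 1)
           + (b + 3 * c + 1) * (b ^+ 2 + b - 4 * p ^+ 2 - 2))
    - (x - 3) * (x - 2)
        * (a ^+ 3 * (b - 2 * c)
           + a ^+ 2 * (b * (10 * b + 9) - 4 * (b + 1) * c)
           + a * (b * (b + 1) * (b - 4 * c + 8) + 6 * c * p ^+ 2 + 2 * c)
           + 2 * c * (- b ^+ 3 - 2 * b ^+ 2 + 3 * p ^+ 2 * (b + c - 3) + b + 2))
    - (x - 2)
        * (a ^+ 3 * b * (4 * b - 3 * c + 2)
           + a ^+ 2 * b * (2 * b + 1) * (2 * b - c)
           - a * (p ^+ 2 * (10 * b - 3 * c ^+ 2 + c)
                  + (b - 1) * b * (b * (3 * c - 2) + 4 * c - 2))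
           + c * p ^+ 2 * (b * (3 * c - 1) + c ^+ 2 - 9))
    - (c + 1) * p ^+ 2 * (c ^+ 2 * (2 * a + 2 * b + 1) - 3 * (a + 1) * (b + 1) * c + 4 * a * b)
    - (a - 1) * a * (b - 1) * b * (- c * (a + b + 1) + 2 * a * b + a + b + 1)).

Definition delta3 (a b c p x : C) : C :=
  - (1 / Dn c x *
  ( (x - 6) * (x - 5) * (x - 4) * (x - 3) * ((a - b) ^+ 2 - 24 * p ^+ 2 - 1)
    + 2 * (x - 5) * (x - 4) * (x - 3)
        * (a ^+ 3 - a ^+ 2 * (b - 2) - a * (b * (b + 4) + 12 * p ^+ 2 + 1)
           + b ^+ 3 + 2 * b ^+ 2 - 12 * p ^+ 2 * (b + c + 1) - b - 2)
    + (x - 4) * (x - 3)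
        * (a ^+ 4 + a ^+ 3 * (2 * b + 3) - a ^+ 2 * (6 * b ^+ 2 + 3 * b + 6 * p ^+ 2 - 1)
           + a * (- 12 * p ^+ 2 * (b + 2 * c) + b * (b * (2 * b - 3) - 8) - 3)
           - 6 * p ^+ 2 * (b ^+ 2 + 4 * b * c + (c - 6) * c - 1)
           + (b + 1) ^+ 2 * (b ^+ 2 + b - 2) + 8 * p ^+ 4)
    + 2 * (x - 3)
        * (- p ^+ 2 * (c ^+ 2 * (3 * a + 3 * b + 1) + c * (a + b) * (3 * a + 3 * b + 2)
                      - 40 * a * b - 13 * c)
           + a * b * (a - b - 1) * (a - b + 1) * (a + b) + 4 * c * p ^+ 4)
    + a ^+ 4 * (b - 1) * b + a ^+ 3 * b * (- 2 * b ^+ 2 + b + 1)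
    + a ^+ 2 * (b ^+ 4 + b ^+ 3
                + p ^+ 2 * (- 12 * b ^+ 2 + 2 * b * (6 * c + 5) - 6 * c ^+ 2 + c)
                - 3 * b ^+ 2 + b)
    + a * p ^+ 2 * (- ((6 * b + 7) * c ^+ 2) + 4 * (b * (3 * b + 2) + 3) * c
                    + 2 * b * (5 * b - 11))
    - a * (b - 1) ^+ 2 * b * (b + 1)
    + c * p ^+ 2 * (b ^+ 2 * (1 - 6 * c) + b * (12 - 7 * c) + 5 * (c - 2) * p ^+ 2 + c + 11))).

Definition delta4 (a b c p x : C) : C :=
  2 * p ^+ 2 / Dn c x *
  ( - 8 * (x - 7) * (x - 6) * (x - 5) * (x - 4)
    - 4 * (x - 6) * (x - 5) * (x - 4) * (3 * (a + b + 1) + c)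
    + 2 * (x - 5) * (x - 4) * (8 * p ^+ 2 - 3 * (a + b - 1) * (a + b + c + 1))
    + (x - 4)
        * (- a ^+ 3 - a ^+ 2 * (3 * b + 3 * c + 2)
           + a * (b * (- 3 * b - 6 * c + 46) - 3 * c + 4 * p ^+ 2 + 1)
           - (b + 3 * c + 1) * (b ^+ 2 + b - 4 * p ^+ 2 - 2))
    + a ^+ 3 * (3 * b - 2 * c) + a ^+ 2 * (3 * (5 - 2 * b) * b - 4 * c)
    + a * (p ^+ 2 * (5 * c - 6 * b) - 4 * b * c + 3 * b * (b * (b + 5) - 4) + 2 * c)
    + 5 * c * p ^+ 2 * (b + c - 3) - 2 * (b - 1) * (b + 1) * (b + 2) * c).

Definition delta5 (a b c p x : C) : C :=
  p ^+ 2 / Dn c x *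
  ( 4 * (x - 8) * (x - 7) * (x - 6) * (x - 5)
    + 8 * (x - 7) * (x - 6) * (x - 5) * (a + b + 1)
    + 6 * (x - 6) * (x - 5) * ((a + b) ^+ 2 - 8 * p ^+ 2 - 1)
    - 2 * (x - 5)
        * (- a ^+ 3 - 3 * a ^+ 2 * b - 2 * a ^+ 2 - 3 * a * b ^+ 2
           + 12 * p ^+ 2 * (a + b + c + 1) + 16 * a * b + a - b ^+ 3 - 2 * b ^+ 2 + b + 2)
    + a ^+ 4 + a ^+ 3 * (3 - 2 * b) + a ^+ 2 * (b * (6 * b - 11) - 5 * p ^+ 2 + 1)
    - a * (2 * b ^+ 3 + 11 * b ^+ 2 - 2 * b * (13 * p ^+ 2 + 6) + 20 * c * p ^+ 2 + 3)
    - 5 * p ^+ 2 * (b ^+ 2 + 4 * b * c + (c - 6) * c - 1)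
    + (b + 1) ^+ 2 * (b ^+ 2 + b - 2) + 4 * p ^+ 4).

Definition delta6 (a b c p x : C) : C :=
  2 * p ^+ 4 * (5 * a ^+ 2 + a * (- 8 * b + 5 * c + 12 * x - 72) + 5 * b ^+ 2 + 5 * b * c
                + 12 * b * (x - 6) + 4 * x * (c + 4 * x) - 29 * c - 196 * x
                - 8 * p ^+ 2 + 595)
  / Dn c x.

Definition delta7 (a b c p x : C) : C :=
  p ^+ 4 * (- 5 * a ^+ 2 + 2 * a * (b - 4 * x + 28) - 5 * b ^+ 2 - 8 * b * (x - 7)
            - 8 * (x - 14) * x + 24 * p ^+ 2 - 387)
  / Dn c x.

Definition delta8 (a b c p x : C) : C := - (16 * p ^+ 6 / Dn c x).

Definition delta9 (a b c p x : C) : C := 4 * p ^+ 6 / Dn c x.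

Definition delta (a b c p : C) (i n : nat) : C :=
  let x := n%:R in
  match i with
  | 0 => delta0 a b c p x | 1 => delta1 a b c p x | 2 => delta2 a b c p x
  | 3 => delta3 a b c p x | 4 => delta4 a b c p x | 5 => delta5 a b c p x
  | 6 => delta6 a b c p x | 7 => delta7 a b c p x | 8 => delta8 a b c p x
  | 9 => delta9 a b c p x | _ => 0
  end.

End Defs.

(* Main.v *)
(** Put S = sinh(pz), F = F(a,b;c;z) and w = SF.

    Both factors have coefficients of at most geometric growth, hence they are
    approximated near 0, to every order N, by their Taylor polynomials up to
    O(z^N), and so is the product by the Cauchy product of the coefficients.
    The series of the u_n has the same property, and such an asymptotic
    expansion is unique: u is the Cauchy product.

    For the recurrence, let r = z(1-z), m = c-(a+b+1)z, q = ab. From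
    S'' = p^2 S and r F'' = q F - m F' one gets
      2r S'F' = m SF' + g,   g = r w'' - (r p^2 + q) w,
    and, differentiating once more, K SF' = h, where K is a polynomial of degree
    4 in z with constant term c(2-c), and h is a differential expression of order
    3 in w. Putting SF' = h/K back into r (SF')' = r S'F' + q w - m SF' gives
      2r (K h' - K' h) + m K h = K^2 (g + 2q w),
    a fourth order equation for w. It is the equation encoded by the recurrence
    multiplied by 1-z: if T_n is D(n) times the defect of the recurrence at n, its
    coefficients are multiples of T_(n-1) - T_n. So T_n does not depend on n,
    and T_1 = 0. *)

Require Import Defs.
From HB Require Import structures.
From mathcomp Require Import all_boot all_order all_algebra.
From mathcomp Require Import complex ring zify.
From mathcomp Require Import all_classical all_reals all_analysis.
Import Order.TTheory GRing.Theory Num.Theory numFieldNormedType.Exports.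

Set Implicit Arguments.
Unset Strict Implicit.
Unset Printing Implicit Defensive.

Local Open Scope ring_scope.
Local Open Scope classical_set_scope.

(** * Asymptotic expansions at 0 *)

Definition conv (R : pzRingType) (s f : nat -> R) (n : nat) : R :=
  \sum_(k < n.+1) s k * f (n - k)%N.

Section Asymptotics.
Variable K : numFieldType.
Implicit Types (a b : nat -> K) (f g : K -> K).

Definition asymp a f := forall N : nat, exists Q r : K,
  [/\ 0 <= Q, 0 < r & forall z, `|z| <= r ->
      `|f z - \sum_(n < N) a n * z ^+ n| <= Q * `|z| ^+ N].

Lemma geometric_tail (x : K) N k : 0 <= x -> 2 * x <= 1 ->
  \sum_(N <= i < N + k) x ^+ i <= 2 * x ^+ N.
Proof.
(* Subtracting [2 * x ^+ (N + k)] from the bound makes the induction on [k] go through. *)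
move=> x0 x1; suff : \sum_(N <= i < N + k) x ^+ i <= 2 * x ^+ N - 2 * x ^+ (N + k).
  by move/le_trans; apply; rewrite gerBl mulr_ge0// exprn_ge0.
elim: k => [|k IH]; first by rewrite addn0 big_geq// subrr.
rewrite addnS big_nat_recr ?leq_addr//=.
apply: (le_trans (lerD IH (lexx _))).
rewrite -subr_ge0 exprS (_ : _ - _ = (1 - 2 * x) * x ^+ (N + k)); last by ring.
by rewrite mulr_ge0 ?subr_ge0// exprn_ge0.
Qed.

Lemma series_tail a (M r z l : K) : 0 <= M -> 0 <= r ->
  (forall n, `|a n| <= M * r ^+ n) -> 2 * (r * `|z|) <= 1 ->
  series (fun n => a n * z ^+ n) @ \oo --> l ->
  forall N, `|l - \sum_(n < N) a n * z ^+ n| <= 2 * M * (r * `|z|) ^+ N.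
Proof.
move=> M0 r0 aM rz1 /cvgrPdist_lt al N.
apply/ler_addgt0Pr => e /al[n0 _ /(_ (N + n0)%N (leq_addl _ _))/= /ltW ln].
rewrite -(subrK (series (fun n => a n * z ^+ n) (N + n0)%N) l) -addrA addrC.
apply: (le_trans (ler_normD _ _)); apply: lerD => //.
rewrite /series/= -(big_mkord xpredT (fun n => a n * z ^+ n)).
rewrite (@big_cat_nat _ _ _ N)//= ?leq_addr// addrC addKr.
apply: (le_trans (ler_norm_sum _ _ _)).
rewrite (mulrC 2) -mulrA.
apply: (@le_trans _ _ (\sum_(N <= i < N + n0) M * (r * `|z|) ^+ i)).
  apply: ler_sum => i _; rewrite normrM normrX exprMn mulrA.
  by rewrite ler_wpM2r ?exprn_ge0.
rewrite -mulr_sumr ler_wpM2l// geometric_tail// mulr_ge0//.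
Qed.

Lemma asymp_series a f (M r d : K) : 0 <= M -> 0 < r -> 0 < d ->
  (forall n, `|a n| <= M * r ^+ n) ->
  (forall z, `|z| <= d -> 2 * (r * `|z|) <= 1 ->
     series (fun n => a n * z ^+ n) @ \oo --> f z) ->
  asymp a f.
Proof.
move=> M0 r0 d0 aM af N.
(* This radius is at most [d] and at most [1 / (2 * r)]. *)
exists (2 * M * r ^+ N), (d / (1 + 2 * (r * d))).
have D0 : 0 < 1 + 2 * (r * d) by rewrite ltr_wpDr// ltW// !mulr_gt0.
split; first by rewrite !mulr_ge0// exprn_ge0// ltW.
  by rewrite divr_gt0.
move=> z zd; rewrite -mulrA -exprMn.
apply: series_tail => //; rewrite ?(ltW r0)//; last apply: af.
- apply: (@le_trans _ _ (2 * (r * (d / (1 + 2 * (r * d)))))).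
    by rewrite ler_pM2l// ler_pM2l.
  by rewrite mulrA mulrA ler_pdivrMr// mul1r -mulrA lerDr.
- apply: (le_trans zd); rewrite ler_pdivrMr// ler_peMr ?ltW// ltrDl !mulr_gt0//.
- apply: (@le_trans _ _ (2 * (r * (d / (1 + 2 * (r * d)))))).
    by rewrite ler_pM2l// ler_pM2l.
  by rewrite mulrA mulrA ler_pdivrMr// mul1r -mulrA lerDr.
Qed.

(** At the first index where the sequences differ, [(a n - b n) * t ^+ n] would be O(t^(n+1)), which
    fails for small [t]. *)
Lemma asymp_inj a b f : asymp a f -> asymp b f -> a =1 b.
Proof.
move=> af bf n; elim/ltn_ind: n => n IH.
have [Q1 [r1 [Q10 r10 h1]]] := af n.+1.
have [Q2 [r2 [Q20 r20 h2]]] := bf n.+1.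
apply/eqP; rewrite -subr_eq0; apply/negP => /negP; rewrite -normr_gt0 => d0.
set d := `|a n - b n| in d0.
set Q := Q1 + Q2 + 1; have Q0 : 0 < Q by rewrite ltr_wpDl// addr_ge0.
(* t lies below r1, r2 and d / Q; min is not available in the partial order of K. *)
pose t := (r1^-1 + r2^-1 + (d / Q)^-1)^-1.
have dQ : 0 < d / Q by rewrite divr_gt0.
have S0 : 0 < r1^-1 + r2^-1 + (d / Q)^-1 by rewrite !addr_gt0 ?invr_gt0.
have t0 : 0 < t by rewrite invr_gt0.
have tr1 : t <= r1.
  by rewrite -[r1]invrK lef_pV2 ?posrE ?invr_gt0// -addrA lerDl addr_ge0 ?invr_ge0 ?ltW.
have tr2 : t <= r2.
  by rewrite -[r2]invrK lef_pV2 ?posrE ?invr_gt0// addrAC lerDr addr_ge0 ?invr_ge0 ?ltW.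
have td : t < d / Q.
  by rewrite -[d / Q]invrK ltf_pV2 ?posrE ?invr_gt0// ltrDr addr_gt0 ?invr_gt0.
have nt : `|t| = t by rewrite gtr0_norm.
have := h1 t; have := h2 t; rewrite nt => /(_ tr2) {}h2 /(_ tr1) {}h1.
have : d * t ^+ n <= (Q1 + Q2) * t ^+ n.+1.
  have E : \sum_(i < n.+1) a i * t ^+ i - \sum_(i < n.+1) b i * t ^+ i
      = (a n - b n) * t ^+ n.
    rewrite !big_ord_recr/= (eq_bigr (fun i : 'I_n => b i * t ^+ i)).
      by rewrite opprD addrACA subrr add0r -mulrBl.
    by move=> i _; rewrite IH.
  rewrite mulrDl; apply: le_trans (lerD h1 h2); rewrite distrC.
  apply: le_trans (ler_normD _ _).
  by rewrite addrA subrK E normrM normrX nt.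
have [t0' d0'] := (ltW t0, ltW d0).
apply/negP; rewrite -real_ltNge ?ger0_real ?mulr_ge0 ?addr_ge0 ?exprn_ge0//.
rewrite exprS mulrA ltr_pM2r ?exprn_gt0//.
move: td; rewrite ltr_pdivlMr// => /(le_lt_trans _); apply.
by rewrite mulrC ler_pM2l// /Q lerDl.
Qed.

(** Passing from [N] to [N.+1] adds one diagonal, which gives each row i the single new entry j = N
    - i. *)
Lemma triangle_sum (V : nmodType) (F : nat -> nat -> V) N :
  \sum_(n < N) \sum_(k < n.+1) F k (n - k)%N =
  \sum_(i < N) \sum_(j < N | (i + j < N)%N) F i j.
Proof.
elim: N => [|N IH]; first by rewrite !big_ord0.
rewrite big_ord_recr/= IH [in RHS]big_ord_recr/=.
rewrite [in LHS]big_ord_recr/= addrA; congr (_ + _).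
  rewrite -big_split/=; apply: eq_bigr => i _.
  rewrite (bigD1 (inord (N - i)))/=; last first.
    by rewrite inordK ?ltnS ?leq_subr// subnKC ?leqnn// ltnW.
  rewrite addrC inordK ?ltnS ?leq_subr//; congr (_ + _).
  rewrite (big_ord_widen_cond N.+1 (fun j => i + j < N)%N (fun j => F i j))//.
  apply: eq_bigl => j; rewrite -val_eqE/= inordK ?ltnS ?leq_subr//.
  have := ltn_ord i; lia.
rewrite (bigD1 ord0)/= ?addn0// subnn big1 ?addr0// => j /andP[].
by rewrite -val_eqE/=; lia.
Qed.

(** The terms left over have i + j >= N, and |z|^(i+j) <= |z|^N because |z| <= 1. *)
Lemma conv_remainder a b (N : nat) (z : K) : `|z| <= 1 ->
  `|(\sum_(n < N) a n * z ^+ n) * (\sum_(n < N) b n * z ^+ n)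
     - \sum_(n < N) conv a b n * z ^+ n|
  <= (\sum_(i < N) \sum_(j < N) `|a i * b j|) * `|z| ^+ N.
Proof.
move=> z1.
have -> : \sum_(n < N) conv a b n * z ^+ n =
    \sum_(i < N) \sum_(j < N | (i + j < N)%N) a i * z ^+ i * (b j * z ^+ j).
  rewrite -(triangle_sum (fun i j => a i * z ^+ i * (b j * z ^+ j))).
  apply: eq_bigr => n _; rewrite /conv mulr_suml; apply: eq_bigr => k _ /=.
  by rewrite mulrACA -exprD subnKC// -ltnS.
rewrite mulr_suml -sumrB mulr_suml.
apply: (le_trans (ler_norm_sum _ _ _)); apply: ler_sum => i _.
rewrite mulr_sumr (bigID (fun j : 'I_N => i + j < N)%N)/= addrC addrK.
apply: (le_trans (ler_norm_sum _ _ _)); rewrite mulr_suml.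
rewrite [leRHS](bigID (fun j : 'I_N => i + j < N)%N)/= ler_wpDl//.
  by apply: sumr_ge0 => j _; rewrite mulr_ge0// exprn_ge0.
apply: ler_sum => j; rewrite -leqNgt => ij.
rewrite mulrACA -exprD normrM normrX ler_wpM2l//.
by rewrite ler_wiXn2l.
Qed.

Lemma asymp_mul a b f g : asymp a f -> asymp b g ->
  asymp (conv a b) (fun z => f z * g z).
Proof.
move=> af bg N.
have [Q1 [r1 [Q10 r10 h1]]] := af N.
have [Q2 [r2 [Q20 r20 h2]]] := bg N.
(* The expansion of order 0 says that [g] is bounded by [Q3] near 0. *)
have [Q3 [r3 [Q30 r30 h3]]] := bg 0%N.
set A := \sum_(n < N) `|a n|.
set B := \sum_(i < N) \sum_(j < N) `|a i * b j|.
have A0 : 0 <= A by apply: sumr_ge0.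
have B0 : 0 <= B by apply: sumr_ge0 => i _; apply: sumr_ge0.
pose t := (r1^-1 + r2^-1 + r3^-1 + 1)^-1.
exists (Q1 * Q3 + A * Q2 + B), t.
have S0 : 0 < r1^-1 + r2^-1 + r3^-1 + 1 by rewrite !addr_gt0 ?invr_gt0.
have [i1 i2 i3] : [/\ 0 <= r1^-1, 0 <= r2^-1 & 0 <= r3^-1].
  by rewrite !invr_ge0 !ltW.
split; first by rewrite !addr_ge0// mulr_ge0.
  by rewrite invr_gt0.
move=> z zr.
have z1 : `|z| <= r1.
  by apply: (le_trans zr); rewrite -[r1]invrK lef_pV2 ?posrE ?invr_gt0// -!addrA lerDl !addr_ge0.
have z2 : `|z| <= r2.
  by apply: (le_trans zr); rewrite -[r2]invrK lef_pV2 ?posrE ?invr_gt0//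
     [r1^-1 + _]addrC -!addrA lerDl !addr_ge0.
have z3 : `|z| <= r3.
  by apply: (le_trans zr); rewrite -[r3]invrK lef_pV2 ?posrE ?invr_gt0// addrAC lerDr !addr_ge0.
have z4 : `|z| <= 1.
  by apply: (le_trans zr); rewrite invf_le1// lerDr !addr_ge0.
have := h1 z z1; have := h2 z z2; have := h3 z z3; have := @conv_remainder a b N z z4.
rewrite big_ord0 subr0 expr0 mulr1 -/B.
set F := \sum_(n < N) a n * _; set G := \sum_(n < N) b n * _; set V := \sum_(n < N) conv a b n * _.
move=> hV hg hG hF.
have FA : `|F| <= A.
  apply: (le_trans (ler_norm_sum _ _ _)); apply: ler_sum => i _.
  by rewrite normrM normrX ler_piMr// exprn_ile1.
rewrite (_ : f z * g z - V = (f z - F) * g z + F * (g z - G) + (F * G - V)); last by ring.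
rewrite [leRHS]mulrDl; apply: (le_trans (ler_normD _ _)); apply: lerD => //.
rewrite [leRHS]mulrDl; apply: (le_trans (ler_normD _ _)); apply: lerD.
  by rewrite normrM mulrAC ler_pM.
by rewrite normrM -mulrA ler_pM.
Qed.

(** The terms of a convergent series tend to 0, hence are bounded. *)
Lemma cvg_series_bound a (z : K) : z != 0 ->
  cvgn (series (fun n => a n * z ^+ n)) ->
  exists2 M : K, 0 <= M & forall n, `|a n| <= M * `|z|^-1 ^+ n.
Proof.
move=> z0 /cvg_series_cvg_0 h.
have [M [Mreal hM]] := cvg_seq_bounded (cvgP _ h).
have M0 : M < `|M| + 1 by rewrite (le_lt_trans (real_ler_norm Mreal))// ltrDl.
exists (`|M| + 1); first by rewrite addr_ge0.
move=> n; have := hM _ M0 n I.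
rewrite /= normrM normrX exprVn ler_pdivlMr// exprn_gt0 ?normr_gt0//.
Qed.
End Asymptotics.

(** * The coefficients of the product *)

Section ComplexSeries.
Variable R : realType.
Local Notation C := (Cplx R).
Implicit Types (x y : nat -> R).

Lemma norm_complex_le (x y : R) : `|(Complex x y : C)| <= ((`|x| + `|y|)%:C)%C.
Proof.
rewrite normc_def lecR/= -[leRHS]ger0_norm ?addr_ge0// -sqrtr_sqr ler_sqrt ?sqr_ge0//.
by rewrite sqrrD !real_normK ?num_real// lerD2r lerDl mulrn_wge0// mulr_ge0.
Qed.

Lemma cvg_complex x y (lx ly : R) : x @ \oo --> lx -> y @ \oo --> ly ->
  (fun n => Complex (x n) (y n) : C) @ \oo --> (Complex lx ly : C).
Proof.
move=> /cvgrPdist_lt xl /cvgrPdist_lt yl; apply/cvgrPdist_lt => e e0.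
(* In the order on complex numbers a positive [e] is real. *)
have eR : e = ((complex.Re e)%:C)%C by rewrite RRe_real// ger0_real// ltW.
have e2 : 0 < complex.Re e / 2 by rewrite divr_gt0// -ltcR -eR.
near=> n.
have -> : (Complex lx ly : C) - Complex (x n) (y n) = Complex (lx - x n) (ly - y n) by [].
apply: (le_lt_trans (norm_complex_le _ _)); rewrite eR ltcR [ltRHS]splitr ltrD//.
  by near: n; exact: xl.
by near: n; exact: yl.
Unshelve. all: by end_near.
Qed.

(** Real and imaginary parts are dominated by a real geometric series, so both converge
    absolutely. *)
Lemma cvg_series_geometric_le (a : nat -> C) (M : C) :
  (forall n, `|a n| <= M * 2^-1 ^+ n) -> cvgn (series a).
Proof.
move=> aM.
have M0 : 0 <= M by have := aM 0%N; rewrite expr0 mulr1; apply: le_trans.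
have MR : M = ((complex.Re M)%:C)%C by rewrite RRe_real// ger0_real.
have bound n : `|a n| <= ((geometric (complex.Re M) (2^-1) n)%:C)%C.
  by apply: (le_trans (aM n)); rewrite {1}MR rmorphM rmorphXn fmorphV rmorph_nat.
have cvgR (f : nat -> R) : (forall n, `|f n| <= geometric (complex.Re M) 2^-1 n) -> cvgn (series f).
  move=> fM; apply: normed_cvg.
  apply: series_le_cvg fM _ => //.
    by move=> n; rewrite mulr_ge0 ?exprn_ge0 ?invr_ge0// -lecR -MR.
  by apply: is_cvg_geometric_series; rewrite ger0_norm ?invr_ge0// invf_lt1// ltr1n.
have /cvgR cRe : forall n, `|complex.Re (a n)| <= geometric (complex.Re M) 2^-1 n.
  by move=> n; rewrite -lecR (le_trans (normc_ge_Re _)).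
have /cvgR cIm : forall n, `|complex.Im (a n)| <= geometric (complex.Re M) 2^-1 n.
  move=> n; rewrite -lecR; apply: le_trans (bound n).
  rewrite normc_def lecR -sqrtr_sqr ler_sqrt ?addr_ge0 ?sqr_ge0//.
  by rewrite lerDr sqr_ge0.
have := cvg_complex cRe cIm.
rewrite (_ : (fun n => Complex _ _) = series a); first exact: cvgP.
apply/funext; elim=> [|n IH]; first by rewrite /series/= !big_geq.
rewrite !seriesSr -IH; by case: (a n).
Qed.
End ComplexSeries.

(** * Growth of the Taylor coefficients of both factors *)

Section Coefficients.
Variable R : realType.
Local Notation C := (Cplx R).
Implicit Types (a b c p : C).

Definition sinh_coef p (k : nat) : C := if odd k then p ^+ k / (k`!)%:R else 0.
Definition hyp_coef a b c (n : nat) : C := poch a n * poch b n / (poch c n * (n`!)%:R).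

(** The base 1 + |p|, unlike |p|, stays positive when p = 0. *)
Lemma sinh_coef_bound p k : `|sinh_coef p k| <= 1 * (1 + `|p|) ^+ k.
Proof.
rewrite mul1r /sinh_coef; case: ifP => _; last first.
  by rewrite normr0 exprn_ge0// addr_ge0.
rewrite normrM normrX normfV normr_nat ler_pdivrMr ?ltr0n ?fact_gt0//.
apply: (@le_trans _ _ ((1 + `|p|) ^+ k)); first by rewrite lerXn2r ?nnegrE ?addr_ge0// lerDr.
by rewrite ler_peMr ?exprn_ge0 ?addr_ge0// ler1n fact_gt0.
Qed.

Lemma pochS a n : poch a n.+1 = poch a n * (a + n%:R).
Proof. by rewrite /poch big_ord_recr. Qed.

Lemma poch_neq0 c n : (forall k : nat, c != - k%:R) -> poch c n != 0.
Proof. by move=> hc; apply/prodf_neq0 => i _; rewrite addr_eq0. Qed.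

(** The hypergeometric differential equation on coefficients, free of division. *)
Lemma hyp_coefS a b c n : (forall k : nat, c != - k%:R) ->
  (n.+1%:R * (c + n%:R)) * hyp_coef a b c n.+1 = (a + n%:R) * (b + n%:R) * hyp_coef a b c n.
Proof.
move=> hc; rewrite /hyp_coef !pochS factS natrM.
have := poch_neq0 n hc; have : c + n%:R != 0 by rewrite addr_eq0.
have : (n`!)%:R != 0 :> C by rewrite pnatr_eq0 -lt0n fact_gt0.
have : n.+1%:R != 0 :> C by rewrite pnatr_eq0.
move: (poch a n) (poch b n) (poch c n) (n.+1%:R) ((n`!)%:R) (n%:R) => A B Cc n1 F n'.
by move=> *; field; repeat (apply/andP; split).
Qed.

(** For n >= N >= |c| + 1 one has |c + n| >= 1, so |b - c| + 1 is enough; the finite sum covers the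
    smaller n, where c + n is never 0. *)
Lemma shift_ratio_bound b c : (forall k : nat, c != - k%:R) ->
  exists2 M : C, 0 <= M & forall n : nat, `|b + n%:R| <= M * `|c + n%:R|.
Proof.
move=> hc.
have [N hN] : exists N : nat, `|c| + 1 <= N%:R.
  have cR : `|c| + 1 = ((complex.Re (`|c| + 1))%:C)%C by rewrite RRe_real// ger0_real// addr_ge0.
  exists (Num.bound (complex.Re (`|c| + 1))); rewrite cR.
  rewrite -[leRHS](rmorph_nat (real_complex R)) lecR ltW//.
  by rewrite archi_boundP// -lecR -cR addr_ge0.
exists (`|b - c| + 1 + \sum_(i < N) `|b + i%:R| / `|c + i%:R|).
  by rewrite !addr_ge0// sumr_ge0// => i _; rewrite divr_ge0.
move=> n; case: (ltnP n N) => nN.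
  rewrite (bigD1 (Ordinal nN))//= addrCA mulrDl.
  rewrite divfK ?normr_eq0 ?addr_eq0//  lerDl mulr_ge0//.
  by rewrite !addr_ge0// sumr_ge0// => i _; rewrite divr_ge0.
have c1 : 1 <= `|c + n%:R|.
  rewrite -(lerD2l `|c|); apply: (le_trans hN); apply: (@le_trans _ _ n%:R).
    by rewrite ler_nat.
  by have := ler_normD (- c) (c + n%:R); rewrite addKr normrN normr_nat.
apply: (@le_trans _ _ ((`|b - c| + 1) * `|c + n%:R|)).
  rewrite mulrDl mul1r (_ : b + n%:R = b - c + (c + n%:R)); last by rewrite addrA subrK.
  by apply: (le_trans (ler_normD _ _)); rewrite lerD2r ler_peMr.
by rewrite ler_wpM2r// lerDl sumr_ge0// => i _; rewrite divr_ge0.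
Qed.

(** In the ratio of consecutive coefficients, |a + n| <= (1 + |a|)(n + 1), and |b + n| / |c + n| is
    bounded. *)
Lemma hyp_coef_bound a b c : (forall k : nat, c != - k%:R) ->
  exists2 M : C, 0 < M & forall n, `|hyp_coef a b c n| <= 1 * M ^+ n.
Proof.
move=> hc; have [M M0 hM] := shift_ratio_bound b hc.
have a1 : 0 <= 1 + `|a| by rewrite addr_ge0.
exists ((1 + `|a|) * (1 + M)).
  by rewrite mulr_gt0// ltr_wpDr.
elim=> [|n IH].
  by rewrite /hyp_coef /poch !big_ord0 fact0 !mul1r invr1 normr1.
have n0 : 0 < `|n.+1%:R * (c + n%:R)|.
  by rewrite normr_gt0 mulf_neq0 ?addr_eq0// pnatr_eq0.
rewrite -(ler_pM2l n0) -normrM hyp_coefS// !normrM normr_nat exprS mul1r.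
rewrite [leRHS](_ : _ = ((1 + `|a|) * n.+1%:R) * ((1 + M) * `|c + n%:R|)
  * ((1 + `|a|) * (1 + M)) ^+ n); last by ring.
rewrite mul1r in IH.
apply: ler_pM => //; last by rewrite -!normrM.
apply: ler_pM => //.
  apply: (le_trans (ler_normD _ _)); rewrite normr_nat -natr1 -subr_ge0.
  rewrite (_ : _ - _ = `|a| * n%:R + 1); last by ring.
  by rewrite addr_ge0// mulr_ge0.
by apply: (le_trans (hM n)); rewrite ler_wpM2r// lerDr.
Qed.
End Coefficients.

(** * Uniqueness of the expansion: u is the Cauchy product *)

Section Identification.
Variable R : realType.
Local Notation C := (Cplx R).
Implicit Types (a b c p : C).

(** Where 2r|z| <= 1, the series is dominated by a geometric one of ratio 1/2. *)
Lemma asymp_limn (a : nat -> C) (M r : C) : 0 <= M -> 0 < r ->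
  (forall n, `|a n| <= M * r ^+ n) ->
  asymp a (fun z => limn (series (fun n => a n * z ^+ n))).
Proof.
move=> M0 r0 aM; apply: (asymp_series M0 r0 ltr01 aM) => z _ rz.
apply: (@cvg_series_geometric_le _ _ M) => n.
rewrite normrM normrX; apply: (@le_trans _ _ (M * (r * `|z|) ^+ n)).
  by rewrite exprMn mulrA ler_wpM2r// exprn_ge0.
rewrite ler_wpM2l// lerXn2r ?nnegrE ?invr_ge0 ?mulr_ge0 ?(ltW r0)//.
by rewrite -[leRHS]mul1r ler_pdivlMr// mulrC.
Qed.

Lemma coef_sinh_hypgeom a b c p (u : nat -> C) : (forall k : nat, c != - k%:R) ->
  (forall z, `|z| < 1 ->
    series (fun n => u n * z ^+ n) @ \oo --> csinh (p * z) * hypgeom a b c z) ->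
  u =1 conv (sinh_coef p) (hyp_coef a b c).
Proof.
move=> hc hu.
have half0 : 0 < 2^-1 :> C by rewrite invr_gt0.
have half1 : 2^-1 < 1 :> C by rewrite invf_lt1// ltr1n.
have sinhE : asymp (sinh_coef p) (fun z => csinh (p * z)).
  have p1 : 0 < 1 + `|p| by rewrite ltr_pwDl.
  have := asymp_limn ler01 p1 (sinh_coef_bound p).
  congr asymp; apply/funext => z; rewrite /csinh; congr (limn (series _)).
  apply/funext => k; rewrite /sinh_coef; case: ifP => _; last by rewrite mul0r.
  by rewrite exprMn mulrAC.
have hypE : asymp (hyp_coef a b c) (hypgeom a b c).
  by have [M M0 hM] := hyp_coef_bound a b hc; apply: (asymp_limn ler01 M0 hM).
apply: asymp_inj (asymp_mul sinhE hypE).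
(* Convergence at z = 1/2 alone bounds the growth of [u]. *)
have [|M M0 hM] := @cvg_series_bound _ u 2^-1 (lt0r_neq0 half0).
  by apply: cvgP; apply: hu; rewrite gtr0_norm.
apply: (asymp_series M0 _ half0 hM); first by rewrite invr_gt0 normr_gt0 lt0r_neq0.
by move=> z z2 _; apply: hu; apply: le_lt_trans half1.
Qed.
End Identification.

(** * The differential equation of the product *)

(* Coefficients are listed downwards from a fixed degree nu: x j, y j and t j
   stand for the coefficients of degree nu - j of w, z S F' and z^2 S' F', so
   that multiplying by z shifts the index. Here m = m0 + m1 z and p2 = p^2. *)
Section Elimination.
Variable R : comNzRingType.
Variables (q m0 m1 p2 nu : R) (x : nat -> R).

Definition idx (j : nat) : R := nu - j%:R.

(* Coefficients of z g and z h. *)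
Definition gcoef j := idx j * (idx j - 1) * x j - (idx j - 1) * (idx j - 2) * x j.+1
  - p2 * (x j.+2 - x j.+3) - q * x j.+1.

Definition hcoef j := 2 * ((idx j - 1) * gcoef j - (idx j - 2) * gcoef j.+1)
  - 4 * q * ((idx j - 1) * x j.+1 - (idx j - 2) * x j.+2)
  + 2 * q * (m0 * x j.+1 + m1 * x j.+2) - (2 - 3 * m0) * gcoef j
  + (4 + 3 * m1) * gcoef j.+1.

(* The equations for w'', r (SF')' and r (S'F')'. *)
Variables (y t : nat -> R).
Hypothesis e3 : forall j, (idx j - 1) * (idx j * x j - y j) = p2 * x j.+2 + t j.
Hypothesis e1 : forall j, (idx j - 1) * y j - (idx j - 2) * y j.+1 =
   t j - t j.+1 + q * x j.+1 - m0 * y j - m1 * y j.+1.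
Hypothesis e2 : forall j, (idx j - 2) * t j - (idx j - 3) * t j.+1 =
   p2 * (y j.+2 - y j.+3) + q * ((idx j - 1) * x j.+1 - y j.+1) - m0 * t j - m1 * t j.+1.

Lemma idxS j : idx j.+1 = idx j - 1.
Proof. by rewrite /idx -natr1; ring. Qed.

(** This is g = 2r S'F' - m SF': [e3] times 1 - z, with r (SF')' eliminated by [e1]. *)
Lemma gcoefE j : gcoef j = 2 * (t j - t j.+1) - m0 * y j - m1 * y j.+1.
Proof.
have E3 := e3 j; have E3' := e3 j.+1; have E1 := e1 j; rewrite idxS in E3'.
apply/eqP; rewrite -subr_eq0; apply/eqP.
transitivity (((idx j - 1) * (idx j * x j - y j) - (p2 * x j.+2 + t j))
 - ((idx j - 1 - 1) * ((idx j - 1) * x j.+1 - y j.+1) - (p2 * x j.+3 + t j.+1))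
 + ((idx j - 1) * y j - (idx j - 2) * y j.+1 - (
   t j - t j.+1 + q * x j.+1 - m0 * y j - m1 * y j.+1))).
  by rewrite /gcoef; ring.
by rewrite E3 E3' E1; ring.
Qed.

(** Here h = 2r g' - 4qr w' + (3m - 2r') g + 2qm w. Differentiating g = 2r S'F' - m SF' and
    eliminating S'F' shows h = K SF' with K = 2r'm - 2rm' - m^2 - 4qr + 4 p2 r^2. *)
Lemma hcoefE j :
  hcoef j = (2 * m0 - m0 ^+ 2) * y j - (4 * m0 + 2 * m0 * m1 + 4 * q) * y j.+1
   + (4 * p2 + 4 * q - 2 * m1 - m1 ^+ 2) * y j.+2 - 8 * p2 * y j.+3 + 4 * p2 * y j.+4.
Proof.
have E2 := e2 j; have E2' := e2 j.+1; have E1 := e1 j; have E1' := e1 j.+1.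
rewrite !idxS in E1' E2'.
apply/eqP; rewrite -subr_eq0; apply/eqP; rewrite /hcoef !gcoefE.
set l1 := RHS in E1; set l1' := RHS in E1'.
set l2 := RHS in E2; set l2' := RHS in E2'.
transitivity (4 * ((idx j - 2) * t j - (idx j - 3) * t j.+1 - l2)
 - 4 * ((idx j - 1 - 2) * t j.+1 - (idx j - 1 - 3) * t j.+2 - l2')
 - 2 * m0 * ((idx j - 1) * y j - (idx j - 2) * y j.+1 - l1)
 - 2 * m1 * ((idx j - 1 - 1) * y j.+1 - (idx j - 1 - 2) * y j.+2 - l1')).
  by rewrite /l1 /l1' /l2 /l2'; ring.
by rewrite E2 E2' E1 E1'; ring.
Qed.

(* Coefficients of z (2r h' + m h), those of K, and those of z (g + 2q w). *)
Definition wcoef j := 2 * ((idx j - 1) * hcoef j - (idx j - 2) * hcoef j.+1)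
  + m0 * hcoef j + m1 * hcoef j.+1.
Definition k0 := 2 * m0 - m0 ^+ 2.
Definition k1 := - (4 * m0 + 2 * m0 * m1 + 4 * q).
Definition k2 := 4 * p2 + 4 * q - 2 * m1 - m1 ^+ 2.
Definition k3 := - (8 * p2).
Definition k4 := 4 * p2.
Definition vcoef j := gcoef j + 2 * q * x j.+1.

(* The second line is K' r h, the last four K^2 (g + 2q w). *)
Definition ode_coef :=
   k0 * wcoef 0 + k1 * wcoef 1 + k2 * wcoef 2 + k3 * wcoef 3 + k4 * wcoef 4
   - 2 * (k1 * hcoef 1 + (2 * k2 - k1) * hcoef 2 + (3 * k3 - 2 * k2) * hcoef 3
          + (4 * k4 - 3 * k3) * hcoef 4 - 4 * k4 * hcoef 5)
   - (k0 ^+ 2 * vcoef 0 + 2 * k0 * k1 * vcoef 1 + (2 * k0 * k2 + k1 ^+ 2) * vcoef 2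
      + 2 * (k0 * k3 + k1 * k2) * vcoef 3 + (2 * (k0 * k4 + k1 * k3) + k2 ^+ 2) * vcoef 4
      + 2 * (k1 * k4 + k2 * k3) * vcoef 5 + (2 * k2 * k4 + k3 ^+ 2) * vcoef 6
      + 2 * k3 * k4 * vcoef 7 + k4 ^+ 2 * vcoef 8).

(** Substituting g = 2r S'F' - m SF' and removing S'F' by [e1] leaves 2r (SF')' + m SF'. *)
Lemma vcoefE j :
  vcoef j = 2 * ((idx j - 1) * y j - (idx j - 2) * y j.+1) + m0 * y j + m1 * y j.+1.
Proof.
rewrite /vcoef gcoefE; have E1 := e1 j.
apply/eqP; rewrite -subr_eq0; apply/eqP.
set l1 := RHS in E1.
transitivity (2 * (l1 - ((idx j - 1) * y j - (idx j - 2) * y j.+1))).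
  by rewrite /l1; ring.
by rewrite E1 subrr mulr0.
Qed.

Lemma hcoef_kappa j :
  hcoef j = k0 * y j + k1 * y j.+1 + k2 * y j.+2 + k3 * y j.+3 + k4 * y j.+4.
Proof. by rewrite hcoefE /k0 /k1 /k2 /k3 /k4; ring. Qed.

(** With h = K SF', both 2r (K h' - K' h) + m K h and K^2 (g + 2qw) equal K^2 (2r (SF')' + m
    SF'). *)
Lemma ode_coef_eq0 : ode_coef = 0.
Proof.
rewrite /ode_coef /wcoef !hcoef_kappa !vcoefE.
(* The cancellation holds for every K of degree at most 4, so its coefficients are generalized. *)
by rewrite !idxS; move: k0 k1 k2 k3 k4 (idx 0) => *; ring.
Qed.
End Elimination.

(** * The recurrence and the differential equation compared *)

Section Defect.
Variable R : realType.
Local Notation C := (Cplx R).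
Variables (a b c p : C).

(* D(z) times the defect of the recurrence at z, for coefficients listed downwards. *)
Definition defect (z : C) (x : nat -> C) :=
  Dn c z * x 0%N
  - (Dn c z * delta0 a b c p z) * x 1%N
  - (Dn c z * delta1 a b c p z) * x 2%N
  - (Dn c z * delta2 a b c p z) * x 3%N
  - (Dn c z * delta3 a b c p z) * x 4%N
  - (Dn c z * delta4 a b c p z) * x 5%N
  - (Dn c z * delta5 a b c p z) * x 6%N
  - (Dn c z * delta6 a b c p z) * x 7%N
  - (Dn c z * delta7 a b c p z) * x 8%N
  - (Dn c z * delta8 a b c p z) * x 9%N
  - (Dn c z * delta9 a b c p z) * x 10%N.

(** This and the next three lemmas cancel D in the shapes of quotient found in [delta1] to
    [delta9]. *)
Lemma mulr_divM (D k E : C) : D != 0 -> D * (k / D * E) = k * E.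
Proof. by move=> D00; rewrite [k / D]mulrC -!mulrA mulVKf. Qed.

Lemma mulr_div (D E : C) : D != 0 -> D * (E / D) = E.
Proof. by move=> D00; rewrite mulrC divfK. Qed.

Lemma mulr_divMN (D k E : C) : D != 0 -> D * - (k / D * E) = - (k * E).
Proof. by move=> D00; rewrite mulrN mulr_divM. Qed.

Lemma mulr_divN (D E : C) : D != 0 -> D * - (E / D) = - E.
Proof. by move=> D00; rewrite mulrN mulr_div. Qed.

(** The denominator of [delta0] lacks the factor z (c + z - 1) of D, which therefore survives. *)
Lemma delta0E z : Dn c z != 0 -> Dn c z * delta0 a b c p z =
  z * (c + z - 1) *
  (2 * (z - 1) ^+ 2 * (a * (c - 2 * b) + c * (b + c - 3))
   + 4 * (c - 2) * (z - 1) * (c * (a + b) - a * b)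
   + 2 * a * b * (c - 2) * (c + 1)).
Proof.
have -> : Dn c z = z * (c + z - 1) * ((c - 2) * c * (z + 1) * (c + z)) by rewrite /Dn; ring.
by rewrite mulf_eq0 negb_or /delta0 => /andP[_ h]; rewrite -mulrA mulr_div.
Qed.

(** A list from degree nu belongs to the recurrence at nu - 1, whose leading term is u_(n+1); the
    shifted list belongs to nu - 2. Once D is cleared this is a polynomial identity. *)
Lemma ode_coef_defect (nu : C) (x : nat -> C) :
  Dn c (nu - 1) != 0 -> Dn c (nu - 2) != 0 ->
  ode_coef (a * b) c (- (a + b + 1)) (p ^+ 2) nu x =
  4 * (defect (nu - 2) (fun i => x i.+1) - defect (nu - 1) x).
Proof.
move=> D0 D1; rewrite /defect !delta0E//.
rewrite {1 2}/delta1 {1 2}/delta2 {1 2}/delta3 {1 2}/delta4 {1 2}/delta5.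
rewrite {1 2}/delta6 {1 2}/delta7 {1 2}/delta8 {1 2}/delta9.
rewrite !(mulr_divM _ _ D0, mulr_divM _ _ D1, mulr_div _ D0, mulr_div _ D1).
rewrite !(mulr_divMN _ _ D0, mulr_divMN _ _ D1, mulr_divN _ D0, mulr_divN _ D1).
rewrite /ode_coef /wcoef /vcoef /hcoef /gcoef /k0 /k1 /k2 /k3 /k4 /idx /Dn.
ring.
Qed.
End Defect.

(** * Euler operator and Cauchy products *)

Section Convolution.
Variable R : comNzRingType.
Implicit Types (s f g : nat -> R).

(** The Euler operator z d/dz on coefficients. *)
Definition theta s (k : nat) : R := k%:R * s k.

Lemma conv_theta s f n :
  n%:R * conv s f n = conv (theta s) f n + conv s (theta f) n.
Proof.
rewrite /conv mulr_sumr -big_split/=; apply: eq_bigr => k _.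
rewrite /theta (_ : n%:R = k%:R + (n - k)%:R); last by rewrite -natrD subnKC// -ltnS.
ring.
Qed.

(** S'' = p^2 S reads theta^2 S = theta S + p^2 z^2 S, and z^2 shifts the index by 2. *)
Lemma conv_theta2_left (s g : nat -> R) (p2 : R) n :
  (forall k, k.+2%:R * k.+1%:R * s k.+2 = p2 * s k) ->
  conv (theta (theta s)) g n =
  conv (theta s) g n + p2 * (if n is m.+2 then conv s g m else 0).
Proof.
move=> hs; rewrite /conv; case: n => [|[|n]].
- by rewrite !big_ord1 /theta/=; ring.
- by rewrite !big_ord_recr !big_ord0/= /theta; ring.
rewrite big_ord_recl big_ord_recl [X in _ = X + _]big_ord_recl [X in _ = _ + X + _]big_ord_recl.
rewrite mulr_sumr -!addrA -big_split/= /bump/= !add1n.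
congr (_ + (_ + _)); rewrite /theta; [ring | ring |].
apply: eq_bigr => k _; rewrite !add1n !subSS [p2 * _]mulrA -hs.
by rewrite -[k.+2%:R]natr1; ring.
Qed.

(** The hypergeometric equation theta (theta + c - 1) F = z (theta + a)(theta + b) F, multiplied by
    [g]. *)
Lemma conv_theta2_right (f g : nat -> R) (a b c : R) n :
  (forall j : nat, (j.+1%:R * (c + j%:R)) * f j.+1 = (a + j%:R) * (b + j%:R) * f j) ->
  conv g (theta (theta f)) n + (c - 1) * conv g (theta f) n =
  if n is m.+1 then conv g (theta (theta f)) m + (a + b) * conv g (theta f) m
    + a * b * conv g f m else 0.
Proof.
move=> hf; rewrite /conv; case: n => [|n].
  by rewrite !big_ord1 subnn /theta/=; ring.
rewrite !mulr_sumr -!big_split/= big_ord_recr/= subnn.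
(* The last term pairs with [f 0], which [theta] kills. *)
rewrite [X in _ + X](_ : _ = 0) ?addr0; last by rewrite /theta; ring.
apply: eq_bigr => k _; rewrite subSn -1?ltnS//.
move: (n - k)%N (hf (n - k)%N) => j hj.
transitivity (g k * (j.+1%:R * (c + j%:R) * f j.+1)); last by rewrite hj /theta; ring.
by rewrite /theta -natr1; ring.
Qed.

(* The coefficients of f listed downwards from degree n, continued by 0. *)
Definition back f (n i : nat) : R := if (i <= n)%N then f (n - i)%N else 0.

Lemma back_gt f n i : (n < i)%N -> back f n i = 0.
Proof. by rewrite /back ltnNge => /negbTE ->. Qed.

Lemma back_le f n i : (i <= n)%N -> back f n i = f (n - i)%N.
Proof. by rewrite /back => ->. Qed.

Lemma back_theta f n i : idx n%:R i * back f n i = back (theta f) n i.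
Proof.
rewrite /back /idx; case: leqP => [h|_]; last by rewrite mulr0.
by rewrite /theta natrB.
Qed.

Lemma back_conv_theta s f n i : idx n%:R i * back (conv s f) n i =
  back (conv (theta s) f) n i + back (conv s (theta f)) n i.
Proof. by rewrite back_theta /back; case: leqP; rewrite ?addr0// /theta conv_theta. Qed.

Lemma back_theta2_left s g p2 n i : (forall k, k.+2%:R * k.+1%:R * s k.+2 = p2 * s k) ->
  back (conv (theta (theta s)) g) n i =
  back (conv (theta s) g) n i + p2 * back (conv s g) n i.+2.
Proof.
move=> hs; case: (leqP i n) => [h|h]; last first.
  by rewrite !back_gt ?mulr0 ?addr0//; lia.
rewrite !(back_le _ h) (conv_theta2_left _ _ hs); case: (leqP i.+2 n) => h2.
  by rewrite back_le// (_ : n - i = (n - i.+2).+2)%N//; lia.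
by rewrite back_gt//; case E : (n - i)%N => [|[|m]]//; lia.
Qed.

Lemma back_theta2_right f g a b c n i :
  (forall j : nat, (j.+1%:R * (c + j%:R)) * f j.+1 = (a + j%:R) * (b + j%:R) * f j) ->
  back (conv g (theta (theta f))) n i + (c - 1) * back (conv g (theta f)) n i =
  back (conv g (theta (theta f))) n i.+1 + (a + b) * back (conv g (theta f)) n i.+1
    + a * b * back (conv g f) n i.+1.
Proof.
move=> hf; case: (leqP i n) => [h|h]; last first.
  by rewrite !back_gt ?mulr0 ?addr0//; lia.
rewrite !(back_le _ h) (conv_theta2_right _ _ hf); case: (leqP i.+1 n) => h2.
  by rewrite !back_le// (_ : n - i = (n - i.+1).+1)%N//; lia.
by rewrite !(back_gt _ h2) (_ : n - i = 0)%N ?mulr0 ?addr0//; lia.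
Qed.

Lemma back_ode s f (a b c p2 : R) n :
  (forall k, k.+2%:R * k.+1%:R * s k.+2 = p2 * s k) ->
  (forall j : nat, (j.+1%:R * (c + j%:R)) * f j.+1 = (a + j%:R) * (b + j%:R) * f j) ->
  ode_coef (a * b) c (- (a + b + 1)) p2 n%:R (back (conv s f) n) = 0.
Proof.
move=> hs hf.
set x := back (conv s f) n.
(* This [y] stands for z S'F. The roles of [y] and [t] in the elimination go to [w], for z SF', and
   [e], for z^2 S'F'. *)
pose y := back (conv (theta s) f) n.
pose w := back (conv s (theta f)) n.
pose e := back (conv (theta s) (theta f)) n.
have Hx i : idx n%:R i * x i = y i + w i by exact: back_conv_theta.
have Hy i : idx n%:R i * y i = y i + p2 * x i.+2 + e i.
  by rewrite back_conv_theta (back_theta2_left _ _ _ hs).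
(* By the Leibniz rule S theta^2 F = theta (S theta F) - theta S theta F, so only the four lists
   occur. *)
have Hw i : idx n%:R i * w i + (c - 1) * w i = e i +
    (idx n%:R i.+1 * w i.+1 - e i.+1 + (a + b) * w i.+1 + a * b * x i.+1).
  rewrite !back_conv_theta -addrA (back_theta2_right _ _ _ hf).
  by rewrite [_ + back _ n i.+1]addrC addrK.
have He i : idx n%:R i * e i + (c - 1) * e i = e i + p2 * w i.+2 +
    (idx n%:R i.+1 * e i.+1 - (e i.+1 + p2 * w i.+3) + (a + b) * e i.+1 + a * b * y i.+1).
  rewrite !back_conv_theta !(back_theta2_left _ _ _ hs) -addrA (back_theta2_right _ _ _ hf).
  by rewrite [_ + back _ n i.+1]addrC addrK.
apply: (ode_coef_eq0 (y := w) (t := e)) => j.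
- rewrite Hx addrK mulrBl mul1r Hy; ring.
- have := Hw j; rewrite idxS => /(canRL (addrK _)) E.
  rewrite mulrBl E; ring.
- have := He j; rewrite idxS => /(canRL (addrK _)) E.
  have Ey : (idx n%:R j - 1) * x j.+1 = y j.+1 + w j.+1 by rewrite -idxS.
  rewrite mulrBl E Ey; ring.
Qed.
End Convolution.

(** * The recurrence for the Cauchy product *)

Section Recurrence.
Variable R : realType.
Local Notation C := (Cplx R).
Variables (a b c p : C).
Hypothesis hc : forall k : nat, c != - k%:R.
Hypothesis hc2 : c != 2.

Lemma sinh_coef_rec k :
  k.+2%:R * k.+1%:R * sinh_coef p k.+2 = p ^+ 2 * sinh_coef p k.
Proof.
rewrite /sinh_coef/= negbK; case: ifP => _; last by rewrite !mulr0.
have := fact_gt0 k; rewrite lt0n -(pnatr_eq0 C) => h.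
rewrite !factS !natrM !exprS.
have := pnatr_eq0 C k.+1; have := pnatr_eq0 C k.+2.
move: (k.+1%:R) (k.+2%:R) ((k`!)%:R) h => k1 k2 F h /negbT h2 /negbT h1.
by field; rewrite h h1 h2.
Qed.

Lemma Dn_neq0 n : (0 < n)%N -> Dn c n%:R != 0.
Proof.
move=> n0.
have c0 : c != 0 by have := hc 0; rewrite oppr0.
have n1 : n%:R + 1 != 0 :> C by rewrite natr1 pnatr_eq0.
have cn1 : c + n%:R - 1 != 0.
  by rewrite -(prednK n0) -natr1 addrA addrK addr_eq0.
by rewrite /Dn !mulf_neq0// ?subr_eq0 ?addr_eq0// pnatr_eq0 -lt0n.
Qed.

Let v := conv (sinh_coef p) (hyp_coef a b c).

Lemma conv_coef0 : v 0%N = 0.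
Proof. by rewrite /v /conv big_ord1 /sinh_coef/= mul0r. Qed.

(** The equation at degree n + 3 gives T_(n+1) = T_(n+2). The chain starts at T_1 because D(0) =
    0. *)
Lemma defect_eq0 n : defect a b c p n.+1%:R (back v n.+2) = 0.
Proof.
elim: n => [|n IH]; last first.
  have := back_ode n.+3 sinh_coef_rec (fun j => hyp_coefS a b j hc).
  have E1 : n.+3%:R - 1 = n.+2%:R :> C by rewrite -[n.+3%:R]natr1 addrK.
  have E2 : n.+3%:R - 2 = n.+1%:R :> C.
    by rewrite -addn2 natrD addrK.
  rewrite ode_coef_defect ?E1 ?E2 ?Dn_neq0//.
  have -> : (fun i => back v n.+3 i.+1) = back v n.+2.
    by apply/funext => i; rewrite /back ltnS subSS.
  rewrite IH sub0r => /eqP; rewrite mulf_eq0 pnatr_eq0/= oppr_eq0 => /eqP//.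
(* As u_0 = 0 and [back] is 0 below degree 0, T_1 = 0 amounts to u_2 = delta_0(1) u_1, where
   delta_0(1) = ab/c. *)
have D1 := @Dn_neq0 1 isT.
rewrite /defect delta0E// /back/= conv_coef0.
rewrite /v /conv !big_ord_recr !big_ord0/= /sinh_coef/= /hyp_coef.
rewrite /Dn /poch !big_ord_recr !big_ord0/=.
have c0 : c != 0 by have := hc 0; rewrite oppr0.
have c1 : c + 1 != 0 by rewrite addr_eq0; exact: (hc 1).
by field; rewrite c0 c1 !pnatr_eq0.
Qed.

Lemma conv_coef_rec n : (9 <= n)%N ->
  v n.+1 = \sum_(i < 10) delta a b c p i n * v (n - i)%N.
Proof.
case: n => // n n9; have := defect_eq0 n; have := @Dn_neq0 n.+1 isT.
(* The bound 9 <= [n.+1] keeps all ten indices in range, so [back] yields true coefficients and not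
   its default 0. *)
have bk i : (i <= n.+1)%N -> back v n.+2 i.+1 = v (n.+1 - i)%N.
  by move=> h; rewrite /back ltnS h subSS.
rewrite /defect {1}/back/= !bk; [|lia..].
move: (Dn c n.+1%:R) => D D0 H.
rewrite !big_ord_recr big_ord0/=.
apply: (mulfI D0); apply/eqP; rewrite -subr_eq0; apply/eqP; apply: etrans H.
by rewrite !subn0; ring.
Qed.
End Recurrence.

(** * The first coefficients *)

Lemma poch0 (R : realType) (a : Cplx R) : poch a 0 = 1.
Proof. exact: big_ord0. Qed.

Lemma poch1 (R : realType) (a : Cplx R) : poch a 1 = a.
Proof. by rewrite /poch big_ord1 addr0. Qed.

(** The Cauchy product of an odd series with one of constant term 1. *)
Lemma conv_odd (R : comNzRingType) (s f : nat -> R) :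
  (forall k, ~~ odd k -> s k = 0) -> f 0%N = 1 ->
  [/\ conv s f 1 = s 1%N, conv s f 2 = s 1%N * f 1%N,
      conv s f 3 = s 1%N * f 2%N + s 3%N,
      conv s f 4 = s 1%N * f 3%N + s 3%N * f 1%N &
      conv s f 5 = s 1%N * f 4%N + s 3%N * f 2%N + s 5%N] /\
  [/\ conv s f 6 = s 1%N * f 5%N + s 3%N * f 3%N + s 5%N * f 1%N,
      conv s f 7 = s 1%N * f 6%N + s 3%N * f 4%N + s 5%N * f 2%N + s 7%N,
      conv s f 8 = s 1%N * f 7%N + s 3%N * f 5%N + s 5%N * f 3%N + s 7%N * f 1%N &
      conv s f 9 = s 1%N * f 8%N + s 3%N * f 6%N + s 5%N * f 4%N + s 7%N * f 2%N
                   + s 9%N].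
Proof.
move=> hs f0; have s0 := hs 0%N isT; have s2 := hs 2%N isT; have s4 := hs 4%N isT.
have s6 := hs 6%N isT; have s8 := hs 8%N isT.
do 2!split; rewrite /conv !big_ord_recr big_ord0/= ?(s0, s2, s4, s6, s8);
  by rewrite ?f0 !(mul0r, mulr1, add0r, addr0).
Qed.

(* s and f are abstract: matching sinh_coef p 7 against sinh_coef p 1, say, would
   end up comparing factorials in unary. *)
Lemma first_coefs (R : realType) (a b c p : Cplx R) (s f u : nat -> Cplx R) :
  (forall k : nat, c != - k%:R) ->
  (forall k, s k = if odd k then p ^+ k / (k`!)%:R else 0) ->
  (forall n, f n = poch a n * poch b n / (poch c n * (n`!)%:R)) ->
  u =1 conv s f ->
    u 0%N = 0 /\ u 1%N = p /\ u 2%N = a * b * p / c /\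
      u 3%N = poch a 2 * poch b 2 * p / (2 * poch c 2) + p ^+ 3 / 6 /\
      u 4%N = a * b * p ^+ 3 / (6 * c) + poch a 3 * poch b 3 * p / (6 * poch c 3) /\
      u 5%N = poch a 2 * poch b 2 * p ^+ 3 / (12 * poch c 2)
              + poch a 4 * poch b 4 * p / (24 * poch c 4) + p ^+ 5 / 120 /\
      u 6%N = a * b * p ^+ 5 / (120 * c) + poch a 3 * poch b 3 * p ^+ 3 / (36 * poch c 3)
              + poch a 5 * poch b 5 * p / (120 * poch c 5) /\
      u 7%N = poch a 2 * poch b 2 * p ^+ 5 / (240 * poch c 2)
              + poch a 4 * poch b 4 * p ^+ 3 / (144 * poch c 4)
              + poch a 6 * poch b 6 * p / (720 * poch c 6) + p ^+ 7 / (7`!)%N%:R /\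
      u 8%N = a * b * p ^+ 7 / ((7`!)%N%:R * c)
              + poch a 3 * poch b 3 * p ^+ 5 / (720 * poch c 3)
              + poch a 5 * poch b 5 * p ^+ 3 / (720 * poch c 5)
              + poch a 7 * poch b 7 * p / ((7`!)%N%:R * poch c 7) /\
      u 9%N = poch a 2 * poch b 2 * p ^+ 7 / ((2 * 7`!)%N%:R * poch c 2)
              + poch a 4 * poch b 4 * p ^+ 5 / (2880 * poch c 4)
              + poch a 6 * poch b 6 * p ^+ 3 / (4320 * poch c 6)
              + poch a 8 * poch b 8 * p / ((8`!)%N%:R * poch c 8)
              + p ^+ 9 / (9`!)%N%:R.
Proof.
move=> hc sE fE uE.
have hp k : poch c k != 0 by exact: poch_neq0.
have c0 : c != 0 by rewrite -(poch1 c).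
have Fn k : (k`!)%:R != 0 :> Cplx R by rewrite pnatr_eq0 -lt0n fact_gt0.
have s0 k : ~~ odd k -> s k = 0 by rewrite sE => /negbTE ->.
have sO k : odd k -> s k = p ^+ k / (k`!)%:R by rewrite sE => ->.
have f0 : f 0%N = 1 by rewrite fE !poch0 !mul1r invr1.
have f1 : f 1%N = a * b / c by rewrite fE !poch1 mulr1.
have f2 : f 2%N = poch a 2 * poch b 2 / (poch c 2 * 2) by rewrite fE.
have f3 : f 3%N = poch a 3 * poch b 3 / (poch c 3 * 6) by rewrite fE.
have f4 : f 4%N = poch a 4 * poch b 4 / (poch c 4 * 24) by rewrite fE.
have f5 : f 5%N = poch a 5 * poch b 5 / (poch c 5 * 120) by rewrite fE.
have f6 : f 6%N = poch a 6 * poch b 6 / (poch c 6 * 720) by rewrite fE.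
have f7 := fE 7%N; have f8 := fE 8%N.
have s1 : s 1%N = p by rewrite sO// divr1.
have s3 : s 3%N = p ^+ 3 / 6 by rewrite sO.
have s5 : s 5%N = p ^+ 5 / 120 by rewrite sO.
have s7 := sO 7%N isT; have s9 := sO 9%N isT.
have F27 : (2 * 7`!)%N%:R = 2 * (7`!)%:R :> Cplx R by exact: natrM.
rewrite {}F27.
have [[u1 u2 u3 u4 u5] [u6 u7 u8 u9]] := conv_odd s0 f0.
(* The factorials of 7, 8 and 9 become unknown nonzero constants, so [field] never evaluates
   them. *)
move: (Fn 7%N) (Fn 8%N) (Fn 9%N) f7 f8 s7 s9.
move: (7`!)%:R (8`!)%:R (9`!)%:R => F7 F8 F9 F70 F80 F90 f7 f8 s7 s9.
rewrite !uE u1 u2 u3 u4 u5 u6 u7 u8 u9 s1 s3 s5 s7 s9 f1 f2 f3 f4 f5 f6 f7 f8.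
have := hp 8%N; have := hp 7%N; have := hp 6%N; have := hp 5%N; have := hp 4%N.
have := hp 3%N; have := hp 2%N.
move: (poch c _) (poch c _) (poch c _) (poch c _) (poch c _) (poch c _) (poch c _)
  => c2 c3 c4 c5 c6 c7 c8 d2 d3 d4 d5 d6 d7 d8.
split; first by rewrite /conv big_ord1 s0// mul0r.
split=> //.
split; first by field.
split; first by field.
split; first by field; rewrite c0 d3.
split; first by field; rewrite d2 d4.
split; first by field; rewrite c0 d3 d5.
split; first by field; rewrite F70 d2 d4 d6.
split; first by field; rewrite F70 c0 d3 d5 d7.
by field; rewrite F70 F80 F90 d2 d4 d6 d8.
Qed.

Theorem theorem3p10 (R : realType) (a b c p : Cplx R)
  (hc : forall k : nat, c != - k%:R) (hc2 : c != 2)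
  (u : nat -> Cplx R)
  (hu : forall z : Cplx R, `|z| < 1 ->
          series (fun n => u n * z ^+ n) @ \oo --> csinh (p * z) * hypgeom a b c z) :
    u 0%N = 0 /\ u 1%N = p /\ u 2%N = a * b * p / c /\
      u 3%N = poch a 2 * poch b 2 * p / (2 * poch c 2) + p ^+ 3 / 6 /\
      u 4%N = a * b * p ^+ 3 / (6 * c) + poch a 3 * poch b 3 * p / (6 * poch c 3) /\
      u 5%N = poch a 2 * poch b 2 * p ^+ 3 / (12 * poch c 2)
              + poch a 4 * poch b 4 * p / (24 * poch c 4) + p ^+ 5 / 120 /\
      u 6%N = a * b * p ^+ 5 / (120 * c) + poch a 3 * poch b 3 * p ^+ 3 / (36 * poch c 3)
              + poch a 5 * poch b 5 * p / (120 * poch c 5) /\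
      u 7%N = poch a 2 * poch b 2 * p ^+ 5 / (240 * poch c 2)
              + poch a 4 * poch b 4 * p ^+ 3 / (144 * poch c 4)
              + poch a 6 * poch b 6 * p / (720 * poch c 6) + p ^+ 7 / (7`!)%N%:R /\
      u 8%N = a * b * p ^+ 7 / ((7`!)%N%:R * c)
              + poch a 3 * poch b 3 * p ^+ 5 / (720 * poch c 3)
              + poch a 5 * poch b 5 * p ^+ 3 / (720 * poch c 5)
              + poch a 7 * poch b 7 * p / ((7`!)%N%:R * poch c 7) /\
      u 9%N = poch a 2 * poch b 2 * p ^+ 7 / ((2 * 7`!)%N%:R * poch c 2)
              + poch a 4 * poch b 4 * p ^+ 5 / (2880 * poch c 4)
              + poch a 6 * poch b 6 * p ^+ 3 / (4320 * poch c 6)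
              + poch a 8 * poch b 8 * p / ((8`!)%N%:R * poch c 8)
              + p ^+ 9 / (9`!)%N%:R /\
    forall n : nat, (9 <= n)%N ->
        u n.+1 = \sum_(i < 10) delta a b c p i n * u (n - i)%N.
Proof.
have uE := coef_sinh_hypgeom hc hu.
have [? [? [? [? [? [? [? [? [? ?]]]]]]]]] :=
  first_coefs hc (fun=> erefl) (fun=> erefl) uE.
do 10!(split; [assumption|]); move=> n n9.
by rewrite uE (conv_coef_rec _ _ _ hc hc2 n9); apply: eq_bigr => i _; rewrite uE.
Qed.
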